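(* $\operatorname{cov}(\mathcal I_\square)=\operatorname{add}(\mathcal M)$.
   Context: Let $X=(\omega^2)^\omega$. $\mathbb P_\square$ is the set of nonempty trees $T\subseteq(\omega^2)^{<\omega}$, closed under initial segments, with a stem (the longest node common to all branches, below which the tree has one path) such that for every $t\in T$ with $t\supseteq\operatorname{stem}(T)$ the successor set $\{a:t^\frown a\in T\}$ contains a final quadrant $E_N=[N,\infty)^2$ for some $N<\omega$; the order is inclusion. The body is $[T]=\{x\in X:\forall n\ x\restriction n\in T\}$. Put $$\mathcal N_\square=\{A\subseteq X:\forall T\in\mathbb P_\square\ \exists S\le T\ ([S]\cap A=\varnothing)\},$$ and let $\mathcal I_\square$ be the $\sigma$-ideal generated by $\mathcal N_\square$. (Equivalently, the bodies $[T]$ form a base of a topology $\tau_\square$ on $X$, $\mathcal N_\square$ is its nowhere dense ideal and $\mathcal I_\square$ its meager ideal.) $\mathcal M$ is the usual meager ideal on $2^\omega$. For a proper ideal $I$ on a set $Z$, $\operatorname{cov}(I)$ is the least size of a subfamily of $I$ covering $Z$, and $\operatorname{add}(I)$ is the least size of a subfamily of $I$ whose union is not in $I$. *)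

(* Defs.v *)
From HB Require Import structures.
From mathcomp Require Import all_boot.
From mathcomp Require Import boolp classical_sets cardinality.
From mathcomp Require Import topology cantor.

Set Implicit Arguments.
Unset Strict Implicit.
Unset Printing Implicit Defensive.

Local Open Scope classical_set_scope.
Local Open Scope card_scope.

Definition node : Type := seq (nat * nat).
Definition X : Type := nat -> nat * nat.

(* The restriction of x to n is [mkseq x n], i.e. [:: x 0; ...; x n.-1]. *)
Definition body (T : set node) : set X := [set x | forall n, T (mkseq x n)].

Definition quadrant (N : nat) : set (nat * nat) :=
  [set a | N <= a.1 /\ N <= a.2].

Definition initial_closed (T : set node) : Prop :=
  forall s t, T t -> prefix s t -> T s.

Definition common_node (T : set node) (s : node) : Prop :=
  T s /\ forall x, body T x -> mkseq x (size s) = s.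

(* The last clause says that T has a single path up to the stem: every node
   that is not longer than s lies on s. *)
Definition is_stem (T : set node) (s : node) : Prop :=
  [/\ common_node T s,
      forall s', common_node T s' -> size s' <= size s &
      forall t, T t -> size t <= size s -> prefix t s].

Definition P_square : set (set node) :=
  [set T | [/\ T !=set0, initial_closed T &
    exists2 s, is_stem T s &
      forall t, T t -> prefix s t ->
        exists N, quadrant N `<=` [set a | T (rcons t a)]]].

Definition N_square : set (set X) :=
  [set A | forall T, P_square T ->
    exists S, [/\ P_square S, S `<=` T & body S `&` A = set0]].

Definition sigma_ideal (Z : Type) (I : set (set Z)) : Prop :=
  [/\ I set0,
      forall A B : set Z, A `<=` B -> I B -> I A &
      forall A : nat -> set Z, (forall n, I (A n)) -> I (\bigcup_n A n)].

Definition I_square : set (set X) := smallest (@sigma_ideal X) N_square.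

Definition nowhere_dense (Z : topologicalType) (A : set Z) : Prop :=
  interior (closure A) = set0.

Definition meager (Z : topologicalType) : set (set Z) :=
  [set A | exists2 F : nat -> set Z,
    (forall n, nowhere_dense (F n)) & A `<=` \bigcup_n F n].

Definition covering_family (Z : Type) (I : set (set Z)) : set (set (set Z)) :=
  [set F | F `<=` I /\ \bigcup_(A in F) A = setT].

Definition nonadditive_family (Z : Type) (I : set (set Z)) :
    set (set (set Z)) :=
  [set F | F `<=` I /\ ~ I (\bigcup_(A in F) A)].

(* Cardinals are represented by sets up to equinumerosity:
   [least_size P K] means that the least size of a member of P exists
   and equals the cardinality of K. *)
Definition least_size (U V : Type) (P : set (set U)) (K : set V) : Prop :=
  (exists2 F, P F & F #= K) /\ (forall F, P F -> K #<= F).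

Definition is_cov (Z V : Type) (I : set (set Z)) (K : set V) : Prop :=
  least_size (covering_family I) K.

Definition is_add (Z V : Type) (I : set (set Z)) (K : set V) : Prop :=
  least_size (nonadditive_family I) K.

(* Main.v *)
Require Import Defs.
From mathcomp Require Import all_boot.
From mathcomp Require Import boolp classical_sets cardinality.
From mathcomp Require Import topology cantor.

(* For a type J of indices, J-indexed unions of meager sets are meager if and
   only if no J-indexed family in I_square covers X; both cardinals are then the
   least size of a J for which this fails.

   If J is additive, families of J functions are eventually bounded and J meager
   sets do not cover the Cantor space.  Let Z_j be the set of nodes above which
   some choice g_j of quadrants avoids the j-th nowhere dense set.  Let g
   eventually bound all the g_j.  A branch of the tree given by g that is Cohen
   generic over it passes infinitely often through Z_j, and past such a node far
   enough out it obeys g_j; hence it avoids all the nowhere dense sets.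

   Conversely, the differences of the two coordinates of a point of X code a
   sequence of finite binary blocks.  A point outside J suitable sets yields
   blocks that infinitely often avoid the j-th nowhere dense set, for every j.
   A second point, chosen after the first, has first coordinates dominating the
   position of the next occurrence.  The sequences that match all the blocks
   of infinitely many of the resulting intervals form a dense G_delta set that
   misses all the given meager sets. *)

Set Implicit Arguments.
Unset Strict Implicit.
Unset Printing Implicit Defensive.

Local Open Scope classical_set_scope.
Local Open Scope card_scope.

(** * Finite sequences and the Cantor topology *)

Definition begins (A : Type) (s : seq A) : set (nat -> A) :=
  [set x | mkseq x (size s) = s].

Lemma take_mkseq_le (A : Type) (x : nat -> A) m n :
  m <= n -> take m (mkseq x n) = mkseq x m.
Proof. by move=> mn; rewrite /mkseq -map_take take_iota (minn_idPl mn). Qed.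

Lemma begins_mkseq (A : Type) (x : nat -> A) n : begins (mkseq x n) x.
Proof. by rewrite /begins /= size_mkseq. Qed.

Lemma beginsP (A : Type) (d : A) (s : seq A) (x : nat -> A) :
  begins s x <-> forall i, i < size s -> x i = nth d s i.
Proof.
split=> [xs i si|H]; first by rewrite -xs nth_mkseq.
apply: (@eq_from_nth _ d); rewrite size_mkseq // => i si.
by rewrite nth_mkseq // H.
Qed.

Lemma begins_catl (A : Type) (s t : seq A) (x : nat -> A) :
  begins (s ++ t) x -> begins s x.
Proof.
rewrite /begins /= => E; have := congr1 (take (size s)) E.
by rewrite take_size_cat // take_mkseq_le // size_cat leq_addr.
Qed.

Lemma begins_prefix (A : eqType) (s t : seq A) (x : nat -> A) :
  begins s x -> begins t x -> size s <= size t -> prefix s t.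
Proof.
rewrite /begins /= => xs xt st; apply/prefixP; exists (drop (size s) t).
by rewrite -{1}xs -(take_mkseq_le x st) xt cat_take_drop.
Qed.

Lemma prefix_begins (A : eqType) (s t : seq A) (x : nat -> A) :
  prefix s t -> begins t x -> begins s x.
Proof. by case/prefixP => u ->; exact: begins_catl. Qed.

Lemma prefix_mkseq (A : eqType) (x : nat -> A) m n :
  m <= n -> prefix (mkseq x m) (mkseq x n).
Proof. by move=> mn; rewrite -(take_mkseq_le x mn) prefix_take. Qed.

Lemma chain_limit (A : eqType) (d : A) (s : nat -> seq A) :
  (forall n, prefix (s n) (s n.+1)) ->
  (forall m, exists n, m <= size (s n)) ->
  exists x, forall n, begins (s n) x.
Proof.
move=> pre unb.
have mono m n : m <= n -> prefix (s m) (s n).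
  move=> /subnKC <-; elim: (n - m) => [|k IH];
  first by rewrite addn0 prefix_refl.
  by rewrite addnS; exact: prefix_trans IH (pre _).
have [h hP] := choice (fun m => unb m.+1).
exists (fun i => nth d (s (h i)) i) => n; apply/(beginsP d) => i si.
have [/mono/prefixP[u E]|/ltnW/mono/prefixP[u E]] := leqP n (h i).
  by rewrite E nth_cat si.
by rewrite E nth_cat hP.
Qed.

Lemma begins_id (A : Type) (d : A) (s : seq A) : begins s (nth d s).
Proof. by apply/(beginsP d). Qed.

Lemma nbhs_begins (s : seq bool) (x : cantor_space) :
  begins s x -> nbhs x (begins s : set cantor_space).
Proof.
move=> xs.
suff: nbhs x [set y : cantor_space | forall i, i < size s -> y i = x i].
  apply: filterS => y H; apply/(beginsP false) => i si.
  by rewrite H //; move/(beginsP false): xs; apply.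
elim: (size s) => [|n IH]; first exact: filterS filterT.
have xn : nbhs x [set y : cantor_space | y n = x n].
  apply: (@proj_continuous _ (fun=> bool) n x [set b | b = x n]).
  by rewrite nbhs_principalE; apply/principal_filterP.
apply: filterS (filterI IH xn) => y [H yn] i; rewrite ltnS leq_eqVlt.
by case/predU1P => [->|/H].
Qed.

(** The product topology is a supremum over the coordinates, so it is enough that the filter
    generated by the cylinders around [x] converges in each coordinate. *)
Lemma nbhs_beginsP (x : cantor_space) (A : set cantor_space) :
  nbhs x A -> exists n, (begins (mkseq x n) : set cantor_space) `<=` A.
Proof.
pose F := filter_from [set: nat]
  (fun n => begins (mkseq x n) : set cantor_space).
have FF : Filter F.
  apply: filter_from_filter; first by exists 0.
  move=> m n _ _; exists (maxn m n) => // y ymn.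
  by split; apply: prefix_begins ymn; apply: prefix_mkseq;
    rewrite ?leq_maxl ?leq_maxr.
suff: F --> x by move=> Fx /Fx [n _ nA]; exists n.
apply/cvg_sup => i U [V [[W oW <-] Wxi] WU].
exists i.+1 => // y /(beginsP false) yx; apply: WU.
by rewrite /= yx ?size_mkseq // nth_mkseq.
Qed.

Lemma nowhere_denseP (A : set cantor_space) :
  nowhere_dense A <->
  forall s, exists t, forall y, begins (s ++ t) y -> ~ A y.
Proof.
rewrite /nowhere_dense; split=> [A0 s|H].
  have : ~ nbhs (nth false s : cantor_space) (closure A).
    by move=> nA; have : (interior (closure A)) (nth false s) := nA; rewrite A0.
  move=> nA; apply: contrapT => H; apply: nA.
  apply: filterS (nbhs_begins (begins_id false s)).
  move=> y ys U /nbhs_beginsP[n nU].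
  pose u := mkseq y (maxn n (size s)).
  have /prefixP[t E] : prefix s u.
    apply: begins_prefix ys (begins_mkseq _ _) _.
    by rewrite size_mkseq leq_maxr.
  apply: contrapT => AU; apply: H; exists t => z; rewrite -E => zu Az.
  apply: AU; exists z; split=> //; apply: nU; apply: prefix_begins zu.
  by apply: prefix_mkseq; exact: leq_maxl.
rewrite -subset0 => x /nbhs_beginsP[n nA]; have [t tA] := H (mkseq x n).
have b := begins_id false (mkseq x n ++ t).
have [z [Az zb]] := nA _ (begins_catl b) _ (nbhs_begins b).
exact: tA Az.
Qed.

(** * Meager sets and blocks *)

Lemma meager_subset (Z : topologicalType) (A B : set Z) :
  A `<=` B -> meager B -> meager A.
Proof. by move=> AB [F Fn BF]; exists F => //; exact: subset_trans BF. Qed.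

Lemma meager_bigcup (Z : topologicalType) (A : nat -> set Z) :
  (forall n, meager (A n)) -> meager (\bigcup_n A n).
Proof.
move=> mA.
have /choice[F FP] n : exists F : nat -> set Z,
    (forall k, nowhere_dense (F k)) /\ A n `<=` \bigcup_k F k.
  by have [F] := mA n; exists F.
exists (fun i => let p := odflt (0, 0) (unpickle i) in F p.1 p.2).
  by move=> i; exact: (FP _).1.
move=> x [n _ /(FP n).2[k _ Fx]]; exists (pickle (n, k)) => //.
by rewrite pickleK.
Qed.

Lemma nowhere_dense_set1 (x : cantor_space) : nowhere_dense [set x].
Proof.
apply/nowhere_denseP => s; exists [:: ~~ x (size s)] => y + yx.
rewrite {}yx cats1 => /(beginsP false)/(_ (size s)).
by rewrite size_rcons nth_rcons ltnn eqxx => /(_ (ltnSn _)); case: (x _).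
Qed.

Lemma nowhere_dense_finU (G : nat -> set cantor_space) n :
  (forall i, nowhere_dense (G i)) ->
  nowhere_dense [set y | exists2 i, i <= n & G i y].
Proof.
move=> nG; apply/nowhere_denseP => s; elim: n => [|n [t IH]].
  have /nowhere_denseP/(_ s)[t tG] := nG 0.
  by exists t => y /tG Gy [i]; rewrite leqn0 => /eqP ->.
have /nowhere_denseP/(_ (s ++ t))[u uG] := nG n.+1.
exists (t ++ u) => y; rewrite catA => yb [i].
rewrite leq_eqVlt => /predU1P[->|ni Gi].
  exact: uG.
by apply: (IH y (begins_catl yb)); exists i.
Qed.

Lemma nowhere_dense_avoid_all (A : set cantor_space) (L : seq (seq bool)) :
  nowhere_dense A ->
  exists w, forall s, s \in L -> forall y, begins (s ++ w) y -> ~ A y.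
Proof.
move=> /nowhere_denseP nA; elim: L => [|s L [w IH]]; first by exists [::].
have [t tA] := nA (s ++ w); exists (w ++ t) => u.
rewrite inE => /predU1P[->|uL] y; rewrite catA; first exact: tA.
by move=> /begins_catl; exact: IH.
Qed.

(** Only finitely many strings have length [p], so one [w] can serve them all. A block can thus be
    chosen from its position alone, whatever precedes it. *)
Lemma nowhere_dense_avoid (A : set cantor_space) p :
  nowhere_dense A ->
  exists w, forall s, size s = p -> forall y, begins (s ++ w) y -> ~ A y.
Proof.
move=> nA; have [w wP] := nowhere_dense_avoid_all
  [seq tval t | t <- enum {: p.-tuple bool}] nA.
exists w => s /eqP sp; apply: wP; apply/mapP.
by exists (Tuple sp); rewrite ?mem_enum.
Qed.

(* The consecutive blocks [c 0], [c 1], ... are read as finite strings placed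
   one after the other: [c n] occupies the positions from [pos c n] up to
   [pos c n.+1]. *)
Definition pos (c : nat -> seq bool) (n : nat) : nat :=
  \sum_(i < n) size (c i).

Definition hits (c : nat -> seq bool) (n : nat) : set cantor_space :=
  [set y | mkseq y (pos c n.+1) = mkseq y (pos c n) ++ c n].

Lemma posS c n : pos c n.+1 = pos c n + size (c n).
Proof. by rewrite /pos big_ord_recr. Qed.

Lemma leq_pos c n : (forall i, 0 < size (c i)) -> n <= pos c n.
Proof.
move=> c0; elim: n => // n IH; rewrite posS.
by rewrite -[n.+1]addn1 leq_add.
Qed.

Lemma flatten_mkseqS (A : Type) (c : nat -> seq A) n :
  flatten (mkseq c n.+1) = flatten (mkseq c n) ++ c n.
Proof. by rewrite mkseqS -cats1 flatten_cat /= cats0. Qed.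

Lemma size_flatten_mkseq c n : size (flatten (mkseq c n)) = pos c n.
Proof.
elim: n => [|n IH]; first by rewrite /pos big_ord0.
by rewrite flatten_mkseqS size_cat IH posS.
Qed.

Lemma blocks_limit c : (forall n, 0 < size (c n)) ->
  exists x : cantor_space, forall n, begins (flatten (mkseq c n)) x.
Proof.
move=> c0; apply: (chain_limit false) => [n|m].
  by rewrite flatten_mkseqS prefix_prefix.
by exists m; rewrite size_flatten_mkseq leq_pos.
Qed.

Lemma begins_hits c (s : seq bool) (y : cantor_space) k :
  size s = pos c k -> begins (s ++ c k) y -> hits c k y.
Proof.
move=> sk yb; rewrite /hits /= posS -sk (begins_catl yb).
by move: yb; rewrite /begins /= size_cat.
Qed.

Lemma blocks_limit_hits c (x : cantor_space) :
  (forall n, begins (flatten (mkseq c n)) x) -> forall n, hits c n x.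
Proof.
move=> H n; apply: (begins_hits (size_flatten_mkseq c n)).
by have := H n.+1; rewrite flatten_mkseqS.
Qed.

(** A point that hits infinitely many of these blocks lies in no [G i]. The final [true] of each
    block serves in [eventually_bounded]. *)
Lemma nowhere_dense_blocks (G : nat -> set cantor_space) :
  (forall n, nowhere_dense (G n)) ->
  exists c, [/\ forall n, 0 < size (c n), forall n, last false (c n) &
    forall i n y, i <= n -> hits c n y -> ~ G i y].
Proof.
move=> nG.
have /choice[w wP] (q : nat * nat) : exists w : seq bool,
    last false w /\ forall y i, i <= q.1 ->
      mkseq y (q.2 + size w) = mkseq y q.2 ++ w -> ~ G i y.
  case: q => n p.
  have [w wP] := nowhere_dense_avoid p (nowhere_dense_finU n nG).
  exists (rcons w true); split; first by rewrite last_rcons.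
  move=> y i /= ni E Gi.
  apply: (wP (mkseq y p) (size_mkseq y p) y); last by exists i.
  apply: (@begins_catl _ _ [:: true]); rewrite -catA cats1.
  by rewrite /begins /= size_cat size_mkseq.
(* The choice of a block depends on where it starts, so the recursion runs on the positions. *)
pose p := fix p n := if n is m.+1 then p m + size (w (m, p m)) else 0.
pose c n := w (n, p n).
have pE n : pos c n = p n.
  by elim: n => [|n IH]; [rewrite /pos big_ord0|rewrite posS IH].
exists c; split=> [n|n|i n y ni].
- by have := (wP (n, p n)).1; rewrite /c; case: (w _).
- exact: (wP (n, p n)).1.
- by rewrite /hits /= posS pE => H; exact: (wP (n, p n)).2 ni H.
Qed.

(** For fixed [m] the set is nowhere dense: pad a string with [false] up to the start of a late
    block [k], then append every block from [k] up to [d k]. *)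
Lemma meager_hits_inf (c : nat -> seq bool) (d : nat -> nat) :
  (forall n, 0 < size (c n)) ->
  meager [set y | exists m, forall k, m <= k ->
    exists2 n, k <= n < d k & ~ hits c n y].
Proof.
move=> c0; exists (fun m => [set y | forall k, m <= k ->
    exists2 n, k <= n < d k & ~ hits c n y]); last by move=> y [m H]; exists m.
move=> m; apply/nowhere_denseP => s; pose k := maxn m (size s).
have sk : size s <= pos c k by apply: leq_trans (leq_pos _ c0); exact: leq_maxr.
pose u j := s ++ nseq (pos c k - size s) false ++
  flatten (mkseq (fun i => c (k + i)) j).
have uS j : u j.+1 = u j ++ c (k + j) by rewrite /u flatten_mkseqS !catA.
have su j : size (u j) = pos c (k + j).
  elim: j => [|j IH].
    by rewrite /u /= cats0 size_cat size_nseq subnKC ?addn0.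
  by rewrite uS size_cat IH addnS posS.
have hu y J : begins (u J) y -> forall j, j < J -> hits c (k + j) y.
  elim: J => // J IH; rewrite uS => yb j; rewrite ltnS leq_eqVlt.
  by move=> /predU1P[->|]; [exact: begins_hits yb|exact: IH (begins_catl yb) j].
exists (nseq (pos c k - size s) false ++
  flatten (mkseq (fun i => c (k + i)) (d k - k))) => y yb /(_ k (leq_maxl _ _)).
move=> [n /andP[kn nd]]; apply; rewrite -(subnKC kn).
by apply: hu yb _ _; rewrite ltn_sub2r // (leq_ltn_trans kn).
Qed.

Lemma meager_cantorT : ~ meager [set: cantor_space].
Proof.
move=> [G nG GT]; have [c [c0 _ cG]] := nowhere_dense_blocks nG.
have [x /blocks_limit_hits xc] := blocks_limit c0.
by have [i _] := GT x I; exact: cG (xc i).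
Qed.

(** * Quadrant trees *)

Lemma prefix_prefix_le (A : eqType) (s t u : seq A) :
  prefix s u -> prefix t u -> size s <= size t -> prefix s t.
Proof.
rewrite !prefixE => /eqP su /eqP tu st.
by rewrite -tu take_takel // su.
Qed.

Lemma prefix_size_eq (A : eqType) (s t : seq A) :
  prefix s t -> size t <= size s -> t = s.
Proof.
by rewrite prefixE => /eqP E ts; rewrite -[RHS]E take_oversize.
Qed.

Lemma quadrant_le m n : m <= n -> quadrant n `<=` quadrant m.
Proof. by move=> mn a [a1 a2]; split; exact: leq_trans mn _. Qed.

Definition follows (g : node -> nat) (s t : node) : Prop :=
  prefix s t /\ forall n, size s <= n < size t ->
    quadrant (g (take n t)) (nth (0, 0) t n).

Definition branch (g : node -> nat) (s : node) : set X :=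
  [set x | begins s x /\ forall n, size s <= n ->
    quadrant (g (mkseq x n)) (x n)].

(** A normal form: stem [s], and exactly the quadrant named by [g] as successor set from there on.
    These trees are dense in [P_square]. *)
Definition quadrant_tree (g : node -> nat) (s : node) : set node :=
  [set t | prefix t s \/ follows g s t].

Lemma follows_refl g s : follows g s s.
Proof.
split=> [|n /andP[sn ns]]; first exact: prefix_refl.
by move: (leq_ltn_trans sn ns); rewrite ltnn.
Qed.

Lemma follows_rcons g s t a :
  follows g s t -> quadrant (g t) a -> follows g s (rcons t a).
Proof.
move=> [st tq] ta; split.
  by apply: prefix_trans st _; exact: prefix_rcons.
move=> n /andP[sn]; rewrite size_rcons ltnS leq_eqVlt nth_rcons -cats1.
case/predU1P => [->|nt]; first by rewrite take_size_cat // ltnn eqxx.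
by rewrite takel_cat ?(ltnW nt) // nt; apply: tq; rewrite sn.
Qed.

Lemma follows_trans g h s t u : (forall v, g v <= h v) ->
  follows g s t -> follows h t u -> follows g s u.
Proof.
move=> gh [st sq] [tu tq]; split; first exact: prefix_trans tu.
move=> n /andP[sn nu]; have [nt|tn] := ltnP n (size t).
  have [v ->] := prefixP tu.
  by rewrite takel_cat ?(ltnW nt) // nth_cat nt; apply: sq; rewrite sn.
by apply: (quadrant_le (gh _)); apply: tq; rewrite tn.
Qed.

Lemma follows_prefix g s t u :
  follows g s u -> prefix s t -> prefix t u -> follows g s t.
Proof.
move=> [su sq] st /prefixP[v E]; split=> // n /andP[sn nt].
have := sq n; rewrite E takel_cat ?(ltnW nt) // nth_cat nt; apply.
by rewrite sn size_cat ltn_addr.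
Qed.

Lemma branch_follows g s x n :
  branch g s x -> size s <= n -> follows g s (mkseq x n).
Proof.
move=> [xs xq] sn; split.
  by apply: begins_prefix xs (begins_mkseq _ _) _; rewrite size_mkseq.
move=> k; rewrite size_mkseq => /andP[sk kn].
by rewrite take_mkseq_le ?(ltnW kn) // nth_mkseq //; exact: xq.
Qed.

Lemma follows_branch g s x :
  (forall n, size s <= n -> follows g s (mkseq x n)) -> branch g s x.
Proof.
move=> H; split.
  exact: prefix_begins (H _ (leqnn _)).1 (begins_mkseq _ _).
move=> n sn; have [_] := H n.+1 (leqW sn).
move/(_ n); rewrite size_mkseq sn ltnSn => /(_ isT).
by rewrite nth_mkseq // take_mkseq_le.
Qed.

Lemma branch_trans g h s t x : (forall v, g v <= h v) ->
  follows g s t -> branch h t x -> branch g s x.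
Proof.
move=> gh st tx; apply: follows_branch => n sn.
have [tn|/ltnW nt] := leqP (size t) n.
  exact: follows_trans gh st (branch_follows tx tn).
apply: (follows_prefix st); last first.
  by apply: begins_prefix (begins_mkseq _ _) tx.1 _; rewrite size_mkseq.
apply: begins_prefix (prefix_begins st.1 tx.1) (begins_mkseq _ _) _.
by rewrite size_mkseq.
Qed.

Lemma branch_nonempty g s : exists x, branch g s x.
Proof.
pose u n := iter n (fun t => rcons t (g t, g t)) s.
have su n : size (u n) = size s + n.
  by elim: n => [|n IH]; rewrite ?addn0 //= size_rcons IH addnS.
have fu n : follows g s (u n).
  elim: n => [|n IH]; first exact: follows_refl.
  by apply: follows_rcons IH _; split => /=.
have [|m|x xu] := @chain_limit _ (0, 0) u.
- by move=> n; exact: prefix_rcons.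
- by exists m; rewrite su leq_addl.
exists x; apply: follows_branch => n sn.
by have := xu (n - size s); rewrite /begins /= su subnKC // => ->.
Qed.

Lemma body_quadrant_tree g s : body (quadrant_tree g s) = branch g s.
Proof.
apply/seteqP; split=> x xs.
  apply: follows_branch => n sn; have [ns|//] := xs n.
  have <- : s = mkseq x n by apply: prefix_size_eq ns _; rewrite size_mkseq.
  exact: follows_refl.
move=> n; have [sn|/ltnW ns] := leqP (size s) n.
  by right; exact: branch_follows xs sn.
by left; apply: begins_prefix (begins_mkseq _ _) xs.1 _; rewrite size_mkseq.
Qed.

Lemma quadrant_tree_closed g s : initial_closed (quadrant_tree g s).
Proof.
move=> t u [us|su] tu; first by left; exact: prefix_trans us.
have [ts|/ltnW st] := leqP (size t) (size s).
  by left; exact: prefix_prefix_le tu su.1 ts.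
by right; apply: (follows_prefix su _ tu); exact: prefix_prefix_le su.1 tu st.
Qed.

Lemma P_square_quadrant_tree g s : P_square (quadrant_tree g s).
Proof.
have Ts : quadrant_tree g s s by right; exact: follows_refl.
split; [by exists s|exact: quadrant_tree_closed|exists s; last first].
  move=> t Tt st; exists (g t) => a ta; right; apply: follows_rcons ta.
  case: Tt => // ts.
  by rewrite (prefix_size_eq ts (size_prefix st)); exact: follows_refl.
split=> [|s' [_ s'P]|t [//|[st _]] ts].
- by split=> // x; rewrite body_quadrant_tree => -[].
- rewrite leqNgt; apply/negP => ss'.
  (* A common node longer than [s] would fix the entry after [s], yet every point of the quadrant at
     [s] occurs there; two distinct points give the contradiction. *)
  have val_at a : quadrant (g s) a -> nth (0, 0) s' (size s) = a.
    move=> ga; have [x xa] := branch_nonempty g (rcons s a).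
    have xs : branch g s x.
      apply: branch_trans xa => //.
      by apply: follows_rcons ga; exact: follows_refl.
    have /(beginsP (0, 0))/(_ _ ss') <- : begins s' x.
      by apply: s'P; rewrite body_quadrant_tree.
    have /(beginsP (0, 0))/(_ (size s)) := xa.1.
    by rewrite size_rcons nth_rcons ltnn eqxx; apply.
  have := val_at (g s, g s); rewrite (val_at (g s, (g s).+1)) //.
  move=> /(_ (conj (leqnn _) (leqnn _)))[] /eqP.
  by rewrite -[X in _ == X]addn0 -addn1 eqn_add2l.
- by rewrite (prefix_size_eq st ts); exact: prefix_refl.
Qed.

Lemma P_square_sub_quadrant_tree T : P_square T ->
  exists s g, quadrant_tree g s `<=` T.
Proof.
move=> [_ Tc [s [[Ts _] _ _] TQ]].
have /choice[g gP] t : exists N, T t -> prefix s t ->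
    quadrant N `<=` [set a | T (rcons t a)].
  have [[Tt st]|H] := pselect (T t /\ prefix s t); last first.
    by exists 0 => Tt st; case: H.
  by have [N NP] := TQ t Tt st; exists N.
exists s, g => t [ts|[st tq]]; first exact: Tc ts.
have takes n : size s <= n -> prefix s (take n t).
  by move=> sn; move: st; rewrite !prefixE take_takel.
suff H n : size s + n <= size t -> T (take (size s + n) t).
  have := H (size t - size s).
  by rewrite subnKC ?(size_prefix st) // take_size; apply.
elim: n => [_|n IH]; first by move: st; rewrite prefixE addn0 => /eqP ->.
rewrite addnS => nt; rewrite (take_nth (0, 0)) //.
apply: (gP _ (IH (ltnW nt))); first by apply: takes; exact: leq_addr.
by apply: tq; rewrite leq_addr.
Qed.

Lemma quadrant_tree_follows g s t h : (forall v, g v <= h v) ->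
  follows g s t -> quadrant_tree h t `<=` quadrant_tree g s.
Proof.
move=> gh st u [ut|tu]; last by right; exact: follows_trans gh st tu.
by apply: (quadrant_tree_closed _ ut); right.
Qed.

Lemma N_squareP A :
  N_square A <-> forall g s, exists h t, follows g s t /\
    forall x, branch h t x -> ~ A x.
Proof.
split=> [NA g s|H T PT].
  have [S [PS Sg SA]] := NA _ (P_square_quadrant_tree g s).
  have [t [h hS]] := P_square_sub_quadrant_tree PS.
  have sub x : branch h t x -> body S x.
    by rewrite -body_quadrant_tree => xh n; exact: hS (xh n).
  have [x xh] := branch_nonempty h t.
  have xg : branch g s x.
    by rewrite -body_quadrant_tree => n; exact: Sg (sub x xh n).
  (* The point [x] is a branch of both trees; cutting it beyond both stems gives a node that follows
     [g] and [h] alike. *)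
  exists h, (mkseq x (maxn (size s) (size t))); split.
    by apply: branch_follows xg _; exact: leq_maxl.
  move=> y yb Ay; suff: set0 y by [].
  rewrite -SA; split=> //; apply: sub; apply: branch_trans yb => //.
  by apply: branch_follows xh _; exact: leq_maxr.
have [s [g gT]] := P_square_sub_quadrant_tree PT.
have [h [t [st tA]]] := H g s.
(* The maximum keeps the new tree inside that of [g] and its branches among those of [h]. *)
pose k v := maxn (g v) (h v).
exists (quadrant_tree k t); split; first exact: P_square_quadrant_tree.
  apply: subset_trans gT; apply: quadrant_tree_follows st => v; exact: leq_maxl.
rewrite body_quadrant_tree -subset0 => x [xk Ax]; apply: tA Ax.
apply: branch_trans (follows_refl h t) xk => v; exact: leq_maxr.
Qed.

Lemma I_square_sub (A B : set X) : A `<=` B -> I_square B -> I_square A.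
Proof.
move=> AB IB J JP; have [[_ Jsub _] _] := JP.
by apply: (Jsub _ _ AB); exact: IB.
Qed.

Lemma I_square_bigcup (A : nat -> set X) :
  (forall n, N_square (A n)) -> I_square (\bigcup_n A n).
Proof.
by move=> NA J [[J0 Jsub JU] NJ]; apply: JU => n; exact: NJ.
Qed.

(** The sets covered by countably many members of [N_square] already form a sigma-ideal, so the
    generated one is contained in it. *)
Lemma I_squareP (A : set X) : I_square A ->
  exists2 B : nat -> set X, (forall n, N_square (B n)) & A `<=` \bigcup_n B n.
Proof.
pose J : set (set X) := [set A | exists2 B : nat -> set X,
  (forall n, N_square (B n)) & A `<=` \bigcup_n B n].
move=> IA; apply: (IA J); split; last first.
  by move=> C NC; exists (fun=> C) => // x Cx; exists 0.
split.
- exists (fun=> set0) => // n; apply/N_squareP => g s.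
  by exists g, s; split=> [|x _ []]; exact: follows_refl.
- by move=> C D CD [B NB DB]; exists B => //; exact: subset_trans DB.
- move=> C CJ.
  have /choice[B BP] n : exists B : nat -> set X,
      (forall k, N_square (B k)) /\ C n `<=` \bigcup_k B k.
    by have [B] := CJ n; exists B.
  exists (fun i => let p := odflt (0, 0) (unpickle i) in B p.1 p.2).
    by move=> i; exact: (BP _).1.
  move=> x [n _ /(BP n).2[k _ Bx]]; exists (pickle (n, k)) => //.
  by rewrite pickleK.
Qed.

(** * Additivity against coverings *)

Definition meager_additive (J : Type) : Prop :=
  forall M : J -> set cantor_space,
    (forall j, meager (M j)) -> meager (\bigcup_j M j).

Definition square_noncovering (J : Type) : Prop :=
  forall A : J -> set X, (forall j, I_square (A j)) ->
    exists x, forall j, ~ A j x.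

Lemma meager_additive_prod (J : Type) :
  meager_additive J -> meager_additive (J * nat).
Proof.
move=> addJ M mM; apply: (@meager_subset _ _ (\bigcup_j \bigcup_n M (j, n))).
  by move=> y [[j n] _ My]; exists j => //; exists n.
by apply: addJ => j; apply: meager_bigcup.
Qed.

(** This is the inequality between the additivity of the meager ideal and the bounding number. The
    bound is read off the end positions of blocks witnessing that a union of [J] meager sets is
    meager. [F j] is a monotone majorant of [f j] that exceeds the identity. *)
Lemma eventually_bounded (J : Type) : meager_additive J ->
  forall f : J -> nat -> nat, exists g : nat -> nat,
    forall j, exists m, forall n, m <= n -> f j n <= g n.
Proof.
move=> addJ f; pose F j n := n.+1 + \sum_(i < n.+1) f j i.
have Fmono j m n : m <= n -> F j m <= F j n.
  move=> /subnKC <-; elim: (n - m) => [|k IH]; first by rewrite addn0.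
  apply: leq_trans IH _; rewrite addnS /F [X in _ <= _ + X]big_ord_recr /=.
  by rewrite leq_add // leq_addr.
have fF j n : f j n <= F j n.
  by rewrite /F big_ord_recr /= addnA leq_addl.
have ltF j n : n < F j n by rewrite /F leq_addr.
(* With these one-bit blocks, missing block [n] means that bit [n] is [true]. The [j]-th meager set
   consists of the sequences with a [true] in every late window from [k] to [F j k]. *)
pose c1 (n : nat) := [:: false].
have pos1 n : pos c1 n = n by rewrite /pos sum1_card card_ord.
have [|G nG UG] := addJ (fun j => [set y | exists m, forall k, m <= k ->
    exists2 n, k <= n < F j k & ~ hits c1 n y]).
  by move=> j; exact: meager_hits_inf.
have [c [c0 clast cG]] := nowhere_dense_blocks nG.
exists (fun n => pos c n.+1) => j; apply: contrapT => unb.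
have {}unb m : exists2 n, m <= n & pos c n.+1 < F j n.
  apply: contrapT => H; apply: unb; exists m => n mn.
  rewrite leqNgt; apply/negP => nf; apply: H; exists n => //.
  exact: leq_trans nf (fF _ _).
(* The blocks of [c] are kept where the bound fails, which is infinitely often, and filled with
   [true] elsewhere. The resulting [x] escapes every [G i] but lies in the [j]-th meager set. *)
pose B n := if pos c n.+1 < F j n then c n else nseq (size (c n)) true.
have sB n : size (B n) = size (c n)
  by rewrite /B; case: ifP; rewrite ?size_nseq.
have posB n : pos B n = pos c n by rewrite /pos; apply: eq_bigr => i _.
have [|x xB] := @blocks_limit B; first by move=> n; rewrite sB.
have xval n i : i < size (c n) -> x (pos c n + i) = nth false (B n) i.
  move=> ic; have /(beginsP false) := xB n.+1.
  rewrite flatten_mkseqS => /(_ (pos c n + i)).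
  rewrite size_cat nth_cat size_flatten_mkseq posB sB ltn_add2l => /(_ ic) ->.
  by rewrite ltnNge leq_addr /= addKn.
have xtrue N k : k < pos c N -> exists2 n, k <= n < F j k & x n = true.
  elim: N => [|N IH]; first by rewrite /pos big_ord0.
  have [/IH //|Nk] := ltnP k (pos c N); rewrite posS => kN.
  (* Now [k] lies in block [N], which either is constantly [true] or ends in a [true] placed before
     [F j N], hence before [F j k]. *)
  have [lF|gF] := boolP (pos c N.+1 < F j N); last first.
    exists k; first by rewrite leqnn ltF.
    have kc : k - pos c N < size (c N) by rewrite ltn_subLR.
    by have := xval N _ kc; rewrite subnKC // /B (negbTE gF) nth_nseq kc.
  exists (pos c N + (size (c N)).-1); last first.
    by rewrite xval ?prednK // /B lF nth_last clast.
  rewrite -ltnS -addnS prednK // kN /=.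
  have FNk : F j N <= F j k by apply: Fmono; exact: leq_trans (leq_pos _ c0) Nk.
  by apply: leq_trans FNk; rewrite -posS ltnW.
have [|i _ Gx] := UG x.
  exists j => //; exists 0 => k _; have [|n kn xn] := xtrue k.+1 k.
    exact: leq_pos.
  exists n => //; rewrite /hits /= !pos1 mkseqS cats1 => /rcons_inj[].
  by rewrite xn.
have [n le_in lF] := unb i.
have := blocks_limit_hits xB n; rewrite /hits /= !posB /B lF => xc.
exact: cG le_in xc Gx.
Qed.

Lemma eventually_bounded_seq (T : countType) (J : Type) : meager_additive J ->
  forall f : J -> seq T -> nat, exists g : seq T -> nat,
    forall j, exists m, forall t, m <= size t -> f j t <= g t.
Proof.
move=> addJ f.
pose dec n : seq T := odflt [::] (unpickle n).
have [g gP] := eventually_bounded addJ (fun j n => f j (dec n)).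
exists (g \o pickle) => j; have [m mP] := gP j.
(* Sequences longer than all those with code below [m] have code at least [m]. *)
exists (\max_(i < m) size (dec i)).+1 => t mt.
have -> : f j t = f j (dec (pickle t)) by rewrite /dec pickleK.
apply: mP; rewrite leqNgt; apply/negP => tm; move: mt; rewrite ltnNge.
by rewrite (bigmax_sup (Ordinal tm)) //= /dec pickleK.
Qed.

(* An element of the Cantor space is decoded into a node following [g]: the
   lengths of its runs of [false] list the successive choices. *)
Definition shift_quadrant (g : node -> nat) (t : node) (k : nat) : nat * nat :=
  let a := odflt (0, 0) (unpickle k) in (g t + a.1, g t + a.2).

(** The state consists of the length of the current run of [false] and the node built so far. *)
Definition read_bit (g : node -> nat) (q : nat * node) (b : bool) :
    nat * node :=
  if b then (0, rcons q.2 (shift_quadrant g q.2 q.1)) else (q.1.+1, q.2).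

Definition decode (g : node -> nat) (s : seq bool) : nat * node :=
  foldl (read_bit g) (0, [::]) s.

Lemma decode_cat g s t : decode g (s ++ t) = foldl (read_bit g) (decode g s) t.
Proof. by rewrite /decode foldl_cat. Qed.

Lemma decode_rcons g s b : decode g (rcons s b) = read_bit g (decode g s) b.
Proof. by rewrite -cats1 decode_cat. Qed.

Lemma decode_follows g s : follows g [::] (decode g s).2.
Proof.
elim/last_ind: s => [|s b IH]; first exact: follows_refl.
rewrite decode_rcons /read_bit; case: b => //=.
by apply: follows_rcons IH _; split; rewrite leq_addr.
Qed.

Lemma decode_prefix g s t : prefix (decode g s).2 (decode g (s ++ t)).2.
Proof.
elim/last_ind: t => [|t b IH]; first by rewrite cats0 prefix_refl.
rewrite -rcons_cat decode_rcons /read_bit; case: b => //=.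
by apply: prefix_trans IH _; exact: prefix_rcons.
Qed.

Lemma decode_nseq_true g s m :
  size (decode g (s ++ nseq m true)).2 = size (decode g s).2 + m.
Proof.
elim: m s => [|m IH] s; first by rewrite cats0 addn0.
by rewrite /= -cat_rcons IH decode_rcons /= size_rcons addSnnS.
Qed.

(** Density of the coding: with no run pending, a string can be extended so as to decode to any
    prescribed further node following [g]. *)
Lemma decode_reach g s u : (decode g s).1 = 0 -> prefix (decode g s).2 u ->
  follows g [::] u -> exists t, decode g (s ++ t) = (0, u).
Proof.
move=> s0; elim/last_ind: u => [|u a IH] su gu.
  by exists [::]; rewrite cats0; case: decode s0 su => /= k [|//] ->.
have [E|ne] := eqVneq (decode g s).2 (rcons u a).
  by exists [::]; rewrite cats0 -E -s0; case: decode.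
have {}su : prefix (decode g s).2 u.
  apply: (prefix_prefix_le su (prefix_rcons _ _)).
  rewrite -ltnS -(size_rcons u a) ltn_neqAle (size_prefix su) andbT.
  apply: contra ne => /eqP E; apply/eqP; apply/esym.
  by apply: prefix_size_eq; rewrite // E.
have gu' : follows g [::] u.
  by apply: follows_prefix gu _ _; rewrite ?prefix0s ?prefix_rcons.
have [t tE] := IH su gu'.
have [_ /(_ (size u))] := gu; rewrite size_rcons ltnSn => /(_ isT).
rewrite -cats1 take_size_cat // nth_cat ltnn subnn /= => -[a1 a2].
(* The length of the run codes the offset of [a] from the corner of the quadrant at [u]. *)
pose k := pickle (a.1 - g u, a.2 - g u).
exists (t ++ nseq k false ++ [:: true]); rewrite catA decode_cat tE.
have -> n : foldl (read_bit g) (0, u) (nseq n false ++ [:: true]) =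
    (0, rcons u (shift_quadrant g u n)).
  have : forall i, foldl (read_bit g) (i, u) (nseq n false ++ [:: true]) =
      (0, rcons u (shift_quadrant g u (i + n))).
    by elim: n => [|n IHn] i; [rewrite addn0|rewrite /= IHn /= addSnnS].
  by apply.
by rewrite cats1 /shift_quadrant /k pickleK /= !subnKC // -surjective_pairing.
Qed.

Lemma decode_dense g s (Z : set node) m :
  (forall t, follows g [::] t -> exists u, follows g t u /\ Z u) ->
  exists t, m <= size (decode g (s ++ t)).2 /\ Z (decode g (s ++ t)).2.
Proof.
(* The [m] bits make the node long enough; the additional [true] closes any pending run, even when
   [m] is 0. *)
move=> Zd; pose s1 := s ++ nseq m true ++ [:: true].
have [u [su Zu]] := Zd _ (decode_follows g s1).
have [||t tE] := @decode_reach g s1 u _ su.1.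
- by rewrite /s1 catA decode_cat /=.
- exact: follows_trans (decode_follows g s1) su.
exists ((nseq m true ++ [:: true]) ++ t); rewrite catA tE; split=> //=.
apply: leq_trans (size_prefix su.1).
rewrite /s1 catA; apply: leq_trans (size_prefix (decode_prefix _ _ _)).
by rewrite decode_nseq_true leq_addl.
Qed.

(** The decoding pulls each dense set of nodes back to a comeager set of the Cantor space. By
    additivity some [y] lies in all of these, and it decodes to [x]. An index [j0] ensures that the
    decoded nodes grow without bound. *)
Lemma generic_branch (J : Type) (g : node -> nat) (Z : J -> set node) :
  inhabited J -> meager_additive J ->
  (forall j t, follows g [::] t -> exists u, follows g t u /\ Z j u) ->
  exists x, branch g [::] x /\
    forall j m, exists2 n, m <= n & Z j (mkseq x n).
Proof.
move=> [j0] addJ Zd.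
pose s (y : cantor_space) n := (decode g (mkseq y n)).2.
pose M j : set cantor_space :=
  [set y | exists m, forall n, m <= size (s y n) -> ~ Z j (s y n)].
have mM j : meager (M j).
  exists (fun m => [set y | forall n, m <= size (s y n) -> ~ Z j (s y n)]).
    move=> m; apply/nowhere_denseP => v.
    have [t [mt Zt]] := decode_dense v m (Zd j).
    by exists t => y yb /(_ (size (v ++ t))); rewrite /s yb => /(_ mt).
  by move=> y [m H]; exists m.
have [y yM] : exists y, forall j, ~ M j y.
  apply: contrapT => H; apply: meager_cantorT.
  apply: meager_subset (addJ M mM) => y _; apply: contrapT => My.
  by apply: H; exists y => j Mj; apply: My; exists j.
have hit j m : exists2 n, m <= size (s y n) & Z j (s y n).
  apply: contrapT => H; apply: (yM j); exists m => n mn Zn.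
  by apply: H; exists n.
have [|m|x xs] := @chain_limit _ (0, 0) (s y).
- by move=> n; rewrite /s mkseqS -cats1 decode_prefix.
- by have [n mn _] := hit j0 m; exists n.
exists x; split=> [|j m]; last first.
  by have [n mn Zn] := hit j m; exists (size (s y n)); rewrite ?xs.
apply: follows_branch => n _; have [k nk _] := hit j0 n.
apply: (follows_prefix (decode_follows g (mkseq y k))); first exact: prefix0s.
by apply: begins_prefix (begins_mkseq _ _) (xs k) _; rewrite size_mkseq.
Qed.

Lemma noncovering_of_additive (J : Type) :
  meager_additive J -> square_noncovering J.
Proof.
move=> addJ A IA.
have [[j0]|nJ] := pselect (inhabited J); last first.
  by exists (fun=> (0, 0)) => j; case: nJ; exists.
have /choice[B BP] j : exists B : nat -> set X,
    (forall n, N_square (B n)) /\ A j `<=` \bigcup_n B n.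
  by have [B] := I_squareP (IA j); exists B.
pose I := (J * nat)%type.
have addI : meager_additive I := meager_additive_prod addJ.
pose C (i : I) := B i.1 i.2.
pose Z i : set node := [set s | exists h, forall x, branch h s x -> ~ C i x].
have /choice[h hP] (p : I * node) : exists h, Z p.1 p.2 ->
    forall x, branch h p.2 x -> ~ C p.1 x.
  have [[h ?]|nZ] := pselect (Z p.1 p.2); first by exists h.
  by exists (fun=> 0).
(* One function bounds, at every node [t], the choices attached to all the
   initial segments of [t]. *)
pose f i (t : node) := \max_(k < (size t).+1) h (i, take k t) t.
have [g gP] := eventually_bounded_seq addI f.
have [|i t gt|x [xg xZ]] := @generic_branch I g Z _ addI.
- by exists; exact: (j0, 0).
- have /N_squareP/(_ g t)[k [u [tu uC]]] := (BP i.1).1 i.2.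
  by exists u; split=> //; exists k.
exists x => j /(BP j).2[n _ Bx]; have [m mP] := gP (j, n).
have [k mk Zk] := xZ (j, n) m.
(* From level [k] on, [g] bounds [f (j, n)], which bounds the choices attached to the node of length
   [k]; so [x] obeys them. *)
apply: (hP ((j, n), mkseq x k) Zk x _ Bx); split; first exact: begins_mkseq.
rewrite size_mkseq => l kl; apply: quadrant_le (xg.2 l isT).
apply: leq_trans (mP _ _); last by rewrite size_mkseq (leq_trans mk).
have kl' : k < (size (mkseq x l)).+1 by rewrite size_mkseq.
by rewrite /f (bigmax_sup (Ordinal kl')) //= take_mkseq_le.
Qed.

(** Only the difference of the coordinates matters, so every word is available in every quadrant.
    The leading [false] keeps blocks nonempty. *)
Definition code_word (a : nat * nat) : seq bool :=
  false :: odflt [::] (unpickle (a.1 - a.2)).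

Lemma additive_of_noncovering (J : Type) :
  square_noncovering J -> meager_additive J.
Proof.
move=> covJ M mM.
have /choice[F FP] j : exists F : nat -> set cantor_space,
    (forall n, nowhere_dense (F n)) /\ M j `<=` \bigcup_n F n.
  by have [F] := mM j; exists F.
pose good j (c : nat -> seq bool) n :=
  forall i y, i <= n -> hits c n y -> ~ F j i y.
have [|x xgood] := covJ (fun j =>
  \bigcup_m [set x : X | forall n, m <= n -> ~ good j (code_word \o x) n]).
  move=> j; apply: I_square_bigcup => m; apply/N_squareP => g s.
  have [t [st mt]] : exists t, follows g s t /\ m <= size t.
    have [z zs] := branch_nonempty g s; exists (mkseq z (maxn (size s) m)).
    rewrite size_mkseq leq_maxr; split=> //.
    exact: branch_follows zs (leq_maxl _ _).
  pose p := pos (code_word \o nth (0, 0) t) (size t).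
  (* The successor makes room for the [false] that [code_word] puts in front of [w]. *)
  have [w wP] := nowhere_dense_avoid p.+1
    (nowhere_dense_finU (size t) (FP j).1).
  pose a := (g t + pickle w, g t).
  exists g, (rcons t a); split.
    by apply: follows_rcons st _; split; rewrite /= ?leq_addr.
  move=> x [xb _] /(_ (size t) mt); apply.
  have xt : begins t x by apply: (@begins_catl _ _ [:: a]); rewrite cats1.
  have xa : code_word (x (size t)) = false :: w.
    have /(beginsP (0, 0))/(_ (size t)) := xb.
    rewrite size_rcons nth_rcons ltnn eqxx => -> //.
    have da : a.1 - a.2 = pickle w by exact: addKn.
    by rewrite /code_word da pickleK.
  have px : pos (code_word \o x) (size t) = p.
    apply: eq_bigr => i _ /=; congr (size (code_word _)).
    by have /(beginsP (0, 0)) -> := xt.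
  move=> i y it yh Fi.
  have {}yh : mkseq y (p + size (false :: w)) = mkseq y p ++ false :: w.
    by rewrite -xa -px -posS; exact: yh.
  apply: (wP (rcons (mkseq y p) false) _ y); last by exists i.
    by rewrite size_rcons size_mkseq.
  by rewrite cat_rcons /begins /= size_cat size_mkseq.
pose c := code_word \o x.
have /choice[h hP] (q : J * nat) : exists n, q.2 <= n /\ good q.1 c n.
  apply: contrapT => H; apply: (xgood q.1); exists q.2 => // n qn gn.
  by apply: H; exists n.
have [|z zP] := covJ (fun j =>
  [set z : X | forall m, exists2 n, m <= n & (z n).1 <= h (j, n)]).
  move=> j.
  pose N := [set z : X | forall m, exists2 n, m <= n &
    (z n).1 <= h (j, n)].
  apply: (@I_square_sub _ (\bigcup_(_ : nat) N)); first by move=> z; exists 0.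
  apply: I_square_bigcup => _; apply/N_squareP => g s.
  (* Beyond the stem, every branch of this tree has first coordinates above [h (j, n)]. *)
  exists (fun t => (h (j, size t)).+1), s; split; first exact: follows_refl.
  move=> z [_ zq] /(_ (size s))[n sn]; rewrite leqNgt.
  by have [] := zq n sn; rewrite size_mkseq => ->.
apply: meager_subset (@meager_hits_inf c (fun k => (z k).1) _) => //.
move=> y [j _ /(FP j).2[i _ Fy]].
have [m mP] : exists m, forall n, m <= n -> h (j, n) < (z n).1.
  apply: contrapT => H; apply: (zP j) => m; apply: contrapT => H'.
  apply: H; exists m => n mn; rewrite ltnNge; apply/negP => zn.
  by apply: H'; exists n.
(* For such [k], block [h (j, k)] is good for [j] and lies between [k] and [(z k).1]. As [i] is at
   most its index, [y] in [F j i] cannot hit it. *)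
exists (maxn m i) => k; rewrite geq_max => /andP[mk ik].
have [/= kh gh] := hP (j, k); exists (h (j, k)); first by rewrite kh mP.
by move=> yh; exact: (gh i y (leq_trans ik kh) yh).
Qed.

(** * Least cardinals *)

Lemma card_le_in_inj (U V : Type) (A : set U) (B : set V) (f : U -> V) :
  (forall x, A x -> B (f x)) ->
  (forall x y, A x -> A y -> f x = f y -> x = y) -> A #<= B.
Proof.
move=> fAB finj.
have /card_eqPle[_ AfA] : f @` A #= A.
  by apply: inj_card_eq => x y /set_mem Ax /set_mem Ay; exact: finj.
by apply: card_le_trans AfA _; apply: subset_card_le => _ [x Ax <-]; exact: fAB.
Qed.

(* Hoenig's argument: apply Zorn's lemma to the sets [H] of choice functions on
   [P] on which every evaluation [h |-> h F] is injective.  Were no evaluation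
   onto, a choice function avoiding all the values of [H] could be added. *)
Lemma exists_least_size (U : Type) (u0 : U) (P : set (set U)) :
  P !=set0 -> exists F0, P F0 /\ forall F, P F -> F0 #<= F.
Proof.
move=> [F1 PF1].
pose Q : set (set (set U -> U)) := [set H | forall F, P F ->
  (forall h, H h -> F (h F)) /\
  (forall h k, H h -> H k -> h F = k F -> h = k)].
have [|H [QH Hmax]] := @Zorn_bigcup _ Q.
  move=> C CQ Ctot F PF; split=> [h [H CH Hh]|h k [H CH Hh] [K CK Kk]].
    exact: (CQ H CH F PF).1.
  have [HK|KH] := Ctot H K CH CK.
    by apply: (CQ K CK F PF).2 => //; exact: HK.
  by apply: (CQ H CH F PF).2 => //; exact: KH.
have [F0 [PF0 F0H]] : exists F0, P F0 /\
    forall u, F0 u -> exists h, H h /\ h F0 = u.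
  apply: contrapT => no.
  have /choice[g gP] F : exists u, P F -> F u /\ forall h, H h -> h F <> u.
    have [PF|nPF] := pselect (P F); last by exists u0.
    apply: contrapT => nu; apply: no; exists F; split=> // u Fu.
    apply: contrapT => nh; apply: nu; exists u => _; split=> // h Hh hu.
    by apply: nh; exists h.
  apply: (Hmax (H `|` [set g])).
    split; first by move=> h; left.
    by move=> /(_ g (or_intror erefl)) Hg; exact: (gP F1 PF1).2 g Hg erefl.
  move=> F PF; split=> [h [Hh|->]|h k].
  - exact: (QH F PF).1.
  - exact: (gP F PF).1.
  move=> [Hh|->] [Hk|->] //.
  - exact: (QH F PF).2.
  - by move=> /((gP F PF).2 h Hh).
  - by move=> /esym /((gP F PF).2 k Hk).
exists F0; split=> // F PF.
have /choice[k kP] u : exists h, F0 u -> H h /\ h F0 = u.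
  have [F0u|nF0u] := pselect (F0 u); last by exists (fun=> u0).
  by have [h hP] := F0H u F0u; exists h.
apply: (@card_le_in_inj _ _ _ _ (fun u => k u F)) => [u F0u|u v F0u F0v].
  exact: (QH F PF).1 _ (kP u F0u).1.
move=> /((QH F PF).2 _ _ (kP u F0u).1 (kP v F0v).1) E.
by rewrite -(kP u F0u).2 E (kP v F0v).2.
Qed.

Lemma card_sig_le (U : Type) (F : set U) : [set: {u | F u}] #<= F.
Proof.
apply: (@card_le_in_inj _ _ _ _ sval) => [u _|u v _ _]; first exact: (svalP u).
exact: eq_sig_hprop (fun=> @Prop_irrelevance _) u v.
Qed.

Lemma nonadditive_sig (F : set (set cantor_space)) :
  nonadditive_family (@meager cantor_space) F ->
  ~ meager_additive {A | F A}.
Proof.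
move=> [FM nU] addF; apply: nU.
apply: meager_subset (addF sval (fun A => FM _ (svalP A))) => y [A FA Ay].
by exists (exist _ A FA).
Qed.

Lemma nonadditive_of_type (J : Type) : ~ meager_additive J ->
  exists2 F, nonadditive_family (@meager cantor_space) F & F #<= [set: J].
Proof.
move=> nadd; apply: contrapT => H; apply: nadd => M mM.
apply: contrapT => nU; apply: H; exists (range M); last exact: card_image_le.
split=> [_ [j _ <-] //|]; apply: contra_not nU; apply: meager_subset.
by move=> y [j _ My]; exists (M j) => //; exists j.
Qed.

Lemma covering_sig (F : set (set X)) :
  covering_family I_square F -> ~ square_noncovering {A | F A}.
Proof.
move=> [FI FT] /(_ sval (fun A => FI _ (svalP A)))[x xF].
have [A FA Ax] : (\bigcup_(A in F) A) x by rewrite FT.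
exact: (xF (exist _ A FA)).
Qed.

Lemma covering_of_type (J : Type) : ~ square_noncovering J ->
  exists2 F, covering_family I_square F & F #<= [set: J].
Proof.
move=> ncov; apply: contrapT => H; apply: ncov => A IA.
apply: contrapT => nx; apply: H; exists (range A); last exact: card_image_le.
split=> [_ [j _ <-] //|]; rewrite -subTset => x _.
apply: contrapT => nAx; apply: nx; exists x => j Ajx; apply: nAx.
by exists (A j) => //; exists j.
Qed.

Theorem corollary5p5 :
  exists (V : Type) (K : set V),
    is_cov I_square K /\ is_add (@meager cantor_space) K.
Proof.
have [|K [PK Kmin]] :=
    exists_least_size set0 (P := nonadditive_family (@meager cantor_space)).
  (* Singletons are nowhere dense, so the family of all meager sets covers the space and a least
     nonadditive family exists. *)
  exists (@meager cantor_space); split=> // mU; apply: meager_cantorT.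
  apply: meager_subset mU => x _; exists [set x] => //.
  exists (fun=> [set x]); last by move=> y ->; exists 0.
  by move=> _; exact: nowhere_dense_set1.
exists (set cantor_space), K; split; last by split=> //; exists K.
have Kcov F : covering_family I_square F -> K #<= F.
  move=> /covering_sig nF; have [|G PG GF] := @nonadditive_of_type {A | F A}.
    by move=> /noncovering_of_additive.
  apply: card_le_trans (Kmin G PG) _; apply: card_le_trans GF _.
  exact: card_sig_le.
(* The converse implication, applied to the index type of [K], gives a covering family no larger
   than [K]; by [Kcov] it has the same size. *)
split=> //; have [|F CF FK] := @covering_of_type {A | K A}.
  by move=> /additive_of_noncovering; exact: nonadditive_sig.
exists F => //; apply: Cantor_Bernstein; last exact: Kcov.
by apply: card_le_trans FK _; exact: card_sig_le.
Qed.
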